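(* If there exists a uniform, countably complete, $\aleph_1$-dense ideal on $\omega_2$, then $\mathrm{PH}_1(\omega_2)$ holds.
   Context: An ideal $\mathcal{I}$ on $\omega_2$ is uniform if it contains every subset of $\omega_2$ of cardinality less than $\aleph_2$ (and is proper), countably complete if closed under countable unions, and $\aleph_1$-dense if the Boolean algebra $\mathcal{P}(\omega_2)/\mathcal{I}$ has a dense subset of cardinality $\aleph_1$. For a directed quasi-order $(P,\le)$ and $m\ge1$: $P^{\le m}=\bigcup_{i=1}^mP^i$; $\mathbf{x}\trianglelefteq\mathbf{y}$ means $\mathbf{x}$ is obtained from $\mathbf{y}$ by deleting coordinates; $P\langle\langle m\rangle\rangle$ is the set of $\sigma=(\sigma(1),\dots,\sigma(m))$ with $\sigma(i)\in P^i$ and $\sigma(1)\trianglelefteq\cdots\trianglelefteq\sigma(m)$ ($P^1=P$). $F:P^{\le m}\to P$ is $m$-cofinal if $x\le F(x)$ for $x\in P$ and $F(\mathbf{x})\le F(\mathbf{y})$ whenever $\mathbf{x}\trianglelefteq\mathbf{y}$; $F^*(\sigma)=(F(\sigma(1)),\dots,F(\sigma(m)))$. $\mathrm{PH}_n(P,\lambda)$: for every $c:P^{n+1}\to\lambda$ there is an $(n+1)$-cofinal $F:P^{\le n+1}\to P$ with $c\circ F^*$ constant. $\mathrm{PH}_n(\varepsilon)=\mathrm{PH}_n(\varepsilon,\omega)$ for an ordinal $\varepsilon$. *)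

(* Defs.v *)
From mathcomp Require Import all_boot all_order.
From mathcomp Require Import all_classical wochoice.

Set Implicit Arguments.
Unset Strict Implicit.
Unset Printing Implicit Defensive.

Local Open Scope classical_set_scope.
Local Open Scope card_scope.

(* |A| = aleph_n; aleph_{n+1} is the least cardinal greater than aleph_n.
   It is enough to compare with the cardinals of subsets of A. *)
Fixpoint is_aleph (n : nat) (T : Type) (A : set T) : Prop :=
  match n with
  | 0 => A #= [set: nat]
  | k.+1 => exists B : set T, [/\ B `<=` A, is_aleph k B, ~ (A #<= B) &
              forall C : set T, C `<=` A -> ~ (A #<= C) -> C #<= B]
  end.

(* W has order type omega_n, the initial ordinal of cardinality aleph_n. *)
Definition is_omega (n : nat) (d : Order.disp_t) (W : orderType d) : Prop :=
  [/\ well_order (<=%O : rel W), is_aleph n [set: W] &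
      forall x : W, ~ ([set: W] #<= [set y : W | (y < x)%O])].

Definition is_ideal (T : Type) (I : set (set T)) : Prop :=
  [/\ I set0, (forall A B : set T, B `<=` A -> I A -> I B) &
      forall A B : set T, I A -> I B -> I (A `|` B)].

(* For T of cardinality kappa, [~ ([set: T] #<= A)] says |A| < kappa. *)
Definition uniform_ideal (T : Type) (I : set (set T)) : Prop :=
  ~ I [set: T] /\ forall A : set T, ~ ([set: T] #<= A) -> I A.

Definition countably_complete (T : Type) (I : set (set T)) : Prop :=
  forall F : nat -> set T, (forall i, I (F i)) -> I (\bigcup_i F i).

(* The Boolean algebra P(T)/I: its elements are the classes [A]_I, and
   [A]_I <= [B]_I iff A \ B belongs to I. *)
Definition ideal_class (T : Type) (I : set (set T)) (A : set T)
  : set (set T) := [set B | I (A `+` B)].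

Definition ideal_quotient (T : Type) (I : set (set T)) : set (set (set T)) :=
  range (ideal_class I).

Definition quotient_le (T : Type) (I : set (set T)) (X Y : set (set T))
  : Prop := exists A B : set T,
    [/\ X = ideal_class I A, Y = ideal_class I B & I (A `\` B)].

Definition quotient_dense (T : Type) (I : set (set T))
    (D : set (set (set T))) : Prop :=
  D `<=` ideal_quotient I `\ ideal_class I set0 /\
  forall X, (ideal_quotient I `\ ideal_class I set0) X ->
    exists2 Y, D Y & quotient_le I Y X.

Definition aleph_dense (n : nat) (T : Type) (I : set (set T)) : Prop :=
  exists D : set (set (set T)), quotient_dense I D /\ is_aleph n D.

Section PartitionHypothesis.
Variables (d : Order.disp_t) (P : preorderType d).

(* The disjoint union of P^1, ..., P^m; the index i : 'I_m stands for the
   length i + 1. *)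
Definition tuples_le (m : nat) : Type := {i : 'I_m & i.+1.-tuple P}.

(* The function sigma is indexed from 0: [sigma i] is sigma(i + 1). *)
Definition is_flag (m : nat) (sigma : forall i : 'I_m, i.+1.-tuple P) : Prop :=
  forall i j : 'I_m, i.+1 = j -> subseq (sigma i) (sigma j).

Definition cofinal_fun (n : nat) (F : tuples_le n.+1 -> P) : Prop :=
  (forall x : P,
     (x <= F (Tagged (fun i : 'I_n.+1 => i.+1.-tuple P) (i := ord0) [tuple x]))%O)
  /\ forall x y : tuples_le n.+1,
       subseq (tagged x) (tagged y) -> (F x <= F y)%O.

Definition star (m : nat) (F : tuples_le m -> P)
    (sigma : forall i : 'I_m, i.+1.-tuple P) : m.-tuple P :=
  [tuple F (Tagged (fun i : 'I_m => i.+1.-tuple P) (sigma i)) | i < m].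

(* The cardinal lambda is replaced by an arbitrary type L of colours; P is
   meant to be directed, which is automatic for a linear order. *)
Definition PH (n : nat) (L : Type) : Prop :=
  forall c : n.+1.-tuple P -> L,
  exists2 F : tuples_le n.+1 -> P, cofinal_fun F &
  exists k : L, forall sigma : forall i : 'I_n.+1, i.+1.-tuple P,
    is_flag sigma -> c (star F sigma) = k.

End PartitionHypothesis.

(* Main.v *)
(* Write A_(a,k) = {z >= a | c(a,z) = k}.  For each a, countable completeness
   makes some A_(a,k) positive, and density puts below its class one of the
   aleph_1 classes Z of the dense set.  The ideal is in fact closed under unions
   of aleph_1 sets of size at most aleph_1, so one pair (k,Z) serves an
   unbounded set X of points a.  For a, b in X, both A_(a,k) and A_(b,k) contain
   Z modulo the ideal, hence they meet.  Take F(x) in X above x and F(x,y) in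
   the intersection of A_(F(x),k) and A_(F(y),k). *)
Require Import Defs.
From mathcomp Require Import all_boot all_order.
From mathcomp Require Import all_classical wochoice.

Local Open Scope classical_set_scope.
Local Open Scope card_scope.

Import Order.TTheory.

(** * Comparison of cardinalities *)

Lemma card_le_rel {T U : Type} {A : set T} {B : set U} (R : T -> U -> Prop) :
  (forall a, A a -> exists2 b, B b & R a b) ->
  (forall a a' b, A a -> A a' -> R a b -> R a' b -> a = a') ->
  A #<= B.
Proof.
move=> Rtot Rinj.
have [->|/set0P[a0 Aa0]] := eqVneq A set0; first exact: card_ge0.
have [b0 Bb0 _] := Rtot a0 Aa0.
have /choice[f fP] : forall a, exists b, A a -> B b /\ R a b.
  move=> a; have [Aa|nAa] := pselect (A a); last by exists b0.
  by have [b Bb Rab] := Rtot a Aa; exists b.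
have finj : {in A &, injective f}.
  move=> x y /set_mem Ax /set_mem Ay fxy; apply: (Rinj x y (f x)) => //.
    by have [] := fP x Ax.
  by rewrite fxy; have [] := fP y Ay.
rewrite -(card_le_eql (inj_card_eq finj)); apply: subset_card_le => _ [x Ax <-].
by have [] := fP x Ax.
Qed.

(** A point of [A] makes [U] inhabited, so the injection on [A] extends to a function on [T]. *)
Lemma card_le_fun {T U : Type} {A : set T} {B : set U} : A #<= B -> A !=set0 ->
  exists f : T -> U, (forall a, A a -> B (f a)) /\ {in A &, injective f}.
Proof.
move=> + [a Aa].
elim/Ppointed: U => U in B *.
  by rewrite !emptyE => A0; move: Aa; rewrite A0.
by move=> /pcard_leP[f]; exists f; split; [exact: funS|exact: inj].
Qed.

(** Zorn gives a maximal graph of a partial injection; were it neither total on [A] nor onto [B],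
    one more pair could be added. *)
Lemma card_le_total {T U : Type} (A : set T) (B : set U) : A #<= B \/ B #<= A.
Proof.
pose P : set (set (T * U)) := fun G => [/\ G `<=` A `*` B,
  forall a b b', G (a, b) -> G (a, b') -> b = b' &
  forall a a' b, G (a, b) -> G (a', b) -> a = a'].
have [F FP Ftot|G [[GAB Gfun Ginj] Gmax]] := @Zorn_bigcup _ P.
  have common p q : (\bigcup_(X in F) X) p -> (\bigcup_(X in F) X) q ->
      exists2 X, F X & X p /\ X q.
    move=> [X FX Xp] [Y FY Yq].
    by have [XY|YX] := Ftot X Y FX FY; [exists Y|exists X] => //; split; auto.
  split=> [p [X /FP[XAB _ _] /XAB]//|a b b' ab ab'|a a' b ab a'b].
    by have [X /FP[_ Xf _] [? ?]] := common _ _ ab ab'; exact: (Xf a).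
  by have [X /FP[_ _ Xi] [? ?]] := common _ _ ab a'b; exact: (Xi _ _ b).
have [domG|/existsNP[a0 /not_implyP[Aa0 a0G]]] :=
  pselect (forall a, A a -> exists b, G (a, b)).
  left; apply: (card_le_rel (fun a b => G (a, b))) => [a /domG[b Gab]|].
    by exists b => //; have [] := GAB _ Gab.
  by move=> a a' b _ _; exact: Ginj.
have [ranG|/existsNP[b0 /not_implyP[Bb0 b0G]]] :=
  pselect (forall b, B b -> exists a, G (a, b)).
  right; apply: (card_le_rel (fun b a => G (a, b))) => [b /ranG[a Gab]|].
    by exists a => //; have [] := GAB _ Gab.
  by move=> b b' a _ _; exact: Gfun.
exfalso; apply: (Gmax (G `|` [set (a0, b0)])).
  split; first by move=> p Gp; left.
  by move=> /(_ (a0, b0) (or_intror erefl)) Gab; apply: a0G; exists b0.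
split.
- by move=> p [/GAB//|->].
- move=> x y y' [Gxy|[-> ->]] [Gxy'|[]]; first exact: Gfun Gxy Gxy'.
  + by move=> xa0 _; case: a0G; exists y; rewrite -xa0.
  + by case: a0G; exists y'.
  + by move=> ->.
- move=> x x' y [Gxy|[-> ->]] [Gxy'|[]]; first exact: Ginj Gxy Gxy'.
  + by move=> _ yb0; case: b0G; exists x; rewrite -yb0.
  + by case: b0G; exists x'.
  + by move=> ->.
Qed.

(** * Sets of size aleph_1 and unions of aleph_1 small sets *)

Lemma aleph1_uncountable {T : Type} {A : set T} : is_aleph 1 A -> ~ countable A.
Proof.
move=> [B [_ /= BN nAB _]] cA; apply: nAB.
by rewrite (card_le_eqr BN).
Qed.

(** The witness [B] of [is_aleph 1 A] is countable and bounds every subset of [A] into which [A]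
    does not inject. *)
Lemma aleph1_subset {T : Type} {A C : set T} : is_aleph 1 A -> C `<=` A ->
  ~ countable C -> A #<= C.
Proof.
move=> [B [_ /= BN _ maxB]] CA nC; apply: contrapT => nAC; apply: nC.
by have := maxB _ CA nAC; rewrite (card_le_eqr BN).
Qed.

(** Otherwise [B] has a copy inside [A]; this copy is uncountable, so [A] injects into it. *)
Lemma aleph1_le {T U : Type} {A : set T} {B : set U} :
  is_aleph 1 A -> is_aleph 1 B -> A #<= B.
Proof.
move=> A1 B1; have [//|/card_subP[C BC CA]] := card_le_total A B.
rewrite -(card_le_eqr BC); apply: aleph1_subset => //.
by move=> cC; apply: (aleph1_uncountable B1); rewrite /countable -(card_le_eql BC).
Qed.

(* A' is an initial segment of A of order type omega_1 for R. *)
Lemma aleph1_wo {T : choiceType} {A : set T} {R : rel T} : well_order R ->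
  is_aleph 1 A -> exists A' : set T, [/\ A' `<=` A, A #<= A' &
    forall x, A' x -> countable [set y | A' y /\ R y x]].
Proof.
move=> Rwo A1.
pose A' := [set x | A x /\ countable [set y | A y /\ R y x]].
have A'A : A' `<=` A by move=> x [].
exists A'; split=> //; last first.
  move=> x [_]; apply: sub_countable; apply: subset_card_le.
  by move=> y [[Ay _]].
have [AA'|/existsNP[x0 /not_implyP[Ax0 A'x0]]] := pselect (A `<=` A').
  exact: subset_card_le.
apply: aleph1_subset => // cA'.
(* The predecessors in [A] of the least [x] of [A] outside [A'] lie in [A'] or equal [x]; if [A'] is
   countable, this puts [x] in [A']. *)
have [|x [[]]] := Rwo [pred x | `[< A x /\ ~ A' x >]].
  by exists x0; apply/asboolP.
move=> /asboolP[Ax nA'x] xmin _; apply: nA'x; split=> //.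
have cU : countable (\bigcup_(b in [set: bool]) if b then A' else [set x]).
  by apply: bigcup_countable => [|[] _] //; exact: countable1.
apply: sub_countable cU; apply: subset_card_le => y [Ay Ryx].
have [A'y|nA'y] := pselect (A' y); first by exists true.
exists false => //=; have Rxy : R x y by apply: xmin; apply/asboolP.
have Rasym := wo_chain_antisymmetric (@withinW _ predT _ Rwo).
by apply: Rasym => //; rewrite Ryx Rxy.
Qed.

(* The union S injects, by t |-> (p t, q t), into the square of a set B' of type
   omega_1.  The pairs with a given maximum are coded by integers; on those with
   a given code the maximum is injective, so S is a countable union of sets of
   size at most aleph_1.  This replaces aleph_1 * aleph_1 = aleph_1. *)
Lemma uniform_ideal_bigcup {T : choiceType} {U : Type} {I : set (set T)}
    {D : set U} (F : U -> set T) :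
  is_aleph 2 [set: T] -> is_ideal I -> uniform_ideal I ->
  countably_complete I -> is_aleph 1 D ->
  (forall u, D u -> ~ ([set: T] #<= F u)) -> I (\bigcup_(u in D) F u).
Proof.
move=> [B [_ B1 nTB maxB]] [I0 Isub _] [_ Iunif] Icc D1 Fsmall.
have [S0|/set0P[t0 [u0 Du0 Ft0]]] := eqVneq (\bigcup_(u in D) F u) set0.
  by rewrite S0.
have [R Rwo] := well_ordering_principle T.
have Rtot : total R by move=> x y; exact: (wo_chainW (@withinW _ predT _ Rwo)).
have [B' [B'B BB' B'seg]] := aleph1_wo Rwo B1.
have nTB' : ~ ([set: T] #<= B').
  by move=> TB'; apply: nTB; apply: card_le_trans TB' (subset_card_le B'B).
have DB' : D #<= B' by apply: card_le_trans BB'; exact: aleph1_le.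
have [i [iB' iinj]] := card_le_fun DB' (ex_intro _ u0 Du0).
(* [maxB] bounds each small [F u] by [B]; [id] is a dummy when [u] is outside [D] or [F u] is
   empty. *)
have /choice[j jP] : forall u, exists j : T -> T, D u ->
    (forall t, F u t -> B' (j t)) /\ {in F u &, injective j}.
  move=> u; have [Du|nDu] := pselect (D u); last by exists id.
  have [F0|/set0P FN0] := eqVneq (F u) set0.
    by exists id; rewrite F0; split=> // x y; rewrite inE.
  have FB' : F u #<= B'.
    by apply: card_le_trans BB'; apply: maxB => //; exact: Fsmall.
  by have [j jP] := card_le_fun FB' FN0; exists j.
have /choice[h hP] : forall x, exists h : T * T -> nat, B' x ->
    {in [set y | B' y /\ R y x] `*` [set y | B' y /\ R y x] &, injective h}.
  move=> x; have [B'x|nB'x] := pselect (B' x); last by exists (fun=> 0%N).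
  have /countable_injP[h hinj] := countableX (B'seg x B'x) (B'seg x B'x).
  by exists h.
have /choice[Y YP] : forall t, exists u, (\bigcup_(u in D) F u) t -> D u /\ F u t.
  move=> t; have [[u Du Fut]|nt] := pselect ((\bigcup_(u in D) F u) t).
    by exists u.
  by exists u0.
pose p t := i (Y t).
pose q t := j (Y t) t.
pose m t := if R (p t) (q t) then q t else p t.
pose S := \bigcup_(u in D) F u.
have B'p t : S t -> B' (p t) by move=> /YP[DY _]; exact: iB'.
have B'q t : S t -> B' (q t) by move=> /YP[DY FY]; have [+ _] := jP _ DY; apply.
have B'm t : S t -> B' (m t).
  by move=> St; rewrite /m; case: ifP => _; [exact: B'q|exact: B'p].
have Rrefl x : R x x by have := Rtot x x; rewrite orbb.
have mp t : R (p t) (m t) by rewrite /m; case: ifP.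
have mq t : R (q t) (m t).
  by rewrite /m; case: ifP => // pq; have := Rtot (p t) (q t); rewrite pq.
have pqinj t t' : S t -> S t' -> p t = p t' -> q t = q t' -> t = t'.
  move=> St St' pt; have [DY FY] := YP t St; have [DY' FY'] := YP t' St'.
  have YY : Y t = Y t' by apply: iinj => //; exact: mem_set.
  have [_ jinj] := jP _ DY.
  by rewrite /q -YY; apply: jinj; apply: mem_set => //; rewrite YY.
pose N n := [set t | S t /\ h (m t) (p t, q t) = n].
(* On [N n] the maximum [m t] and the code [n] determine the pair, hence [t]; so [N n] injects into
   [B']. *)
have IN n : I (N n).
  apply: Iunif => TN; apply: nTB'; apply: card_le_trans TN _.
  apply: (card_le_rel (fun t x => m t = x)) => [t [St _]|t t' x].
    by exists (m t) => //; exact: B'm.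
  move=> [St htn] [St' ht'n] <- mt.
  have : (p t, q t) = (p t', q t').
    apply: (hP (m t)); first exact: B'm.
    - by apply: mem_set; split; split; [exact: B'p|exact: mp|exact: B'q|exact: mq].
    - apply: mem_set; rewrite -mt.
      by split; split; [exact: B'p|exact: mp|exact: B'q|exact: mq].
    - by rewrite htn -mt ht'n.
  by case; exact: pqinj.
apply: Isub (Icc _ IN) => t St.
by exists (h (m t) (p t, q t)).
Qed.

(** * Classes modulo an ideal *)

Lemma ideal_class_eq0 {T : Type} {I : set (set T)} {A : set T} :
  is_ideal I -> ideal_class I A = ideal_class I set0 <-> I A.
Proof.
move=> [I0 Isub IU]; split=> [A0|IA].
  have : ideal_class I A A by rewrite /ideal_class /= setYK.
  by rewrite A0 /ideal_class /= set0Y.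
apply/seteqP; split=> B /=; rewrite /ideal_class /= set0Y => IB.
  apply: Isub (IU _ _ IA IB) => x Bx.
  by have [Ax|nAx] := pselect (A x); [left|right; right].
by apply: Isub (IU _ _ IA IB) => x [[]|[]]; [left|right].
Qed.

(* [quotient_le] only provides some representatives of the two classes. *)
Lemma quotient_le_class {T : Type} {I : set (set T)} {A B : set T} :
  is_ideal I -> quotient_le I (ideal_class I A) (ideal_class I B) -> I (A `\` B).
Proof.
move=> [I0 Isub IU] [A' [B' [AA' BB' IAB]]].
have classP X Y : ideal_class I X = ideal_class I Y -> I (X `+` Y).
  move=> XY; have : ideal_class I Y Y by rewrite /ideal_class /= setYK.
  by rewrite -XY.
(* [A \ B] is covered by [A' \ B'] and the symmetric differences of [A], [A'] and of [B], [B']. *)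
apply: Isub (IU _ _ IAB (IU _ _ (classP _ _ AA') (classP _ _ BB'))).
move=> x [Ax nBx].
have [A'x|nA'x] := pselect (A' x); last by right; left; left.
have [B'x|nB'x] := pselect (B' x); last by left.
by right; right; right.
Qed.

(** * Construction of the cofinal function *)

Theorem theorem8p11 (d : Order.disp_t) (W : orderType d) (hW : is_omega 2 W) :
  (exists I : set (set W),
     [/\ is_ideal I, uniform_ideal I, countably_complete I & aleph_dense 1 I]) ->
  PH W 1 nat.
Proof.
move=> [I [Iid Iunif Icc [D [[Dsub Ddense] D1]]]] c.
have [_ W2 seg_small] := hW.
have [I0 Isub IU] := Iid.
have [nIW Ismall] := Iunif.
pose A a k := [set z : W | (a <= z)%O /\ c [tuple a; z] = k].
have /choice[K /choice[Y KY]] : forall a, exists k, exists Y,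
    D Y /\ quotient_le I Y (ideal_class I (A a k)).
  move=> a.
  (* Otherwise [W] is the union of the small segment below [a] and countably many sets of the
     ideal. *)
  have [k nIA] : exists k, ~ I (A a k).
    apply: contrapT => /forallNP IA; apply: nIW.
    have IA' k : I (A a k) by apply: contrapT; exact: IA.
    apply: Isub (IU _ _ (Ismall _ (seg_small a)) (Icc _ IA')) => z _.
    have [az|za] := leP a z; last by left.
    by right; exists (c [tuple a; z]).
  have [|X DX leX] := Ddense (ideal_class I (A a k)).
    by split; [exists (A a k)|move=> /= /(ideal_class_eq0 Iid)].
  by exists k, X.
pose X k Z := [set a | K a = k /\ Y a = Z].
have [k [Z [DZ Xunb]]] : exists k Z, D Z /\
    forall x, exists2 a, X k Z a & (x <= a)%O.
  apply: contrapT => noX; apply: nIW.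
  (* A bounded [X k Z] lies in a proper initial segment, so it is small. The unions over [Z], taken
     for all [k], cover [W]. *)
  have IX k : I (\bigcup_(Z in D) X k Z).
    apply: uniform_ideal_bigcup => // Z DZ WX; apply: noX.
    exists k, Z; split=> // x; apply: contrapT => nx; apply: (seg_small x).
    apply: card_le_trans WX (subset_card_le _) => a Xa /=.
    by rewrite ltNge; apply/negP => xa; apply: nx; exists a.
  apply: Isub (Icc _ IX) => a _.
  by have [DYa _] := KY a; exists (K a) => //; exists (Y a).
have [[A0 _ ZA0] Z0] := Dsub _ DZ.
have nIA0 : ~ I A0 by move=> /(ideal_class_eq0 Iid) A00; apply: Z0; rewrite -ZA0.
have meet a b : X k Z a -> X k Z b -> exists z, A a k z /\ A b k z.
  have IX e : X k Z e -> I (A0 `\` A e k).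
    by move=> [<- Ye]; apply: quotient_le_class => //; rewrite ZA0 -Ye; have [] := KY e.
  (* If [A a k] and [A b k] were disjoint, the positive set [A0] would be covered by two sets of the
     ideal. *)
  move=> /IX Ia /IX Ib; apply: contrapT => noz; apply: nIA0.
  apply: Isub (IU _ _ Ia Ib) => z A0z.
  have [Aaz|nAaz] := pselect (A a k z); last by left.
  by right; split=> // Abz; apply: noz; exists z.
have /choice[f fP] : forall x, exists a, X k Z a /\ (x <= a)%O.
  by move=> x; have [a] := Xunb x; exists a.
have /choice[g gP] : forall ab : W * W, exists z,
    A (f ab.1) k z /\ A (f ab.2) k z.
  by move=> [a b]; apply: meet; [have [] := fP a|have [] := fP b].
pose F (t : tuples_le W 2) : W := let s := tagged t in
  if tag t == ord0 then f (thead s) else g (thead s, last (thead s) s).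
have FE (t : tuples_le W 2) : (exists2 x, tval (tagged t) = [:: x] & F t = f x) \/
    (exists2 xy, tval (tagged t) = [:: xy.1; xy.2] & F t = g xy).
  case: t => -[[|[|//]] i2] [s /= ss].
    by left; case: s ss => [|x []] //= ss; exists x.
  by right; case: s ss => [|x [|y []]] //= ss; exists (x, y).
(* Both properties of [F] rest on this: it gives [f x <= g xy] and the colour [k] at once. *)
have fg x xy : x \in [:: xy.1; xy.2] -> A (f x) k (g xy).
  by have [? ?] := gP xy; rewrite !inE => /orP[] /eqP ->.
exists F.
  split=> [x|s t]; first by have [] := fP x.
  have [[x -> ->]|[x -> ->]] := FE s; have [[y -> ->]|[y -> ->]] := FE t.
  - by rewrite sub1seq inE => /eqP ->.
  - by rewrite sub1seq => /fg[].
  - by move=> /size_subseq.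
  (* A subsequence of full length is the whole sequence. *)
  - move=> xy; have /eqP[x1y1 x2y2] : [:: x.1; x.2] == [:: y.1; y.2].
      by rewrite -(geq_leqif (size_subseq_leqif xy)).
    by rewrite [x]surjective_pairing x1y1 x2y2 -surjective_pairing.
exists k => sigma sigmaP.
pose t1 : tuples_le W 2 := Tagged _ (sigma ord0).
pose t2 : tuples_le W 2 := Tagged _ (sigma ord_max).
have -> : star F sigma = [tuple F t1; F t2].
  apply: eq_from_tnth => i; rewrite tnth_mktuple.
  by have [->|->] : i = ord0 \/ i = ord_max;
    first by case: i => [[|[|//]] i2]; [left|right]; exact: val_inj.
have : subseq (tagged t1) (tagged t2) by exact: sigmaP.
(* The lengths 1 and 2 of the two entries of the flag rule out the other forms in [FE]. *)
have [[x -> ->]|[x t1x _]] := FE t1; last first.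
  by have := size_tuple (tagged t1); rewrite t1x.
have [[y t2y _]|[y -> ->]] := FE t2.
  by have := size_tuple (tagged t2); rewrite t2y.
by rewrite sub1seq => /fg[].
Qed.
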